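(* Let $k$ be a field of characteristic $0$, let $\Phi(X_0,X_1)=\sum_{W\in\{X_0,X_1\}^*}Z_W W\in k\langle\langle X_0,X_1\rangle\rangle$ be a group-like element whose coefficients in degree $1$ are zero, and let $B$ be a basis of $U\mathfrak B_5$. For a word $W$ in the letters $X_{34},X_{45},X_{24},X_{12},X_{23}$ write $W=\sum_{b\in B}l_{b,W}\,b$ in $U\mathfrak B_5$, with $l_{b,W}\in k$. Then the relation $$\Phi(X_{12},X_{23})\Phi(X_{34},X_{45})\Phi(X_{51},X_{12})\Phi(X_{23},X_{34})\Phi(X_{45},X_{51})=1\quad\text{in }U\mathfrak B_5$$ is equivalent to the family of relations $$\forall\, b\in B,\ b\neq 1,\qquad \sum_{W\in\{X_{34},X_{45},X_{24},X_{12},X_{23}\}^*} l_{b,W}\,C_{5,W}=0,$$ where $$C_{5,W}=\sum_{\substack{U_1,\ldots,U_5\in\{X_{34},X_{45},X_{24},X_{12},X_{23}\}^*\\ U_1\cdots U_5=W}} Z_{\rho_1(U_1)}Z_{\rho_2(U_2)}Z_{\rho_3(U_3)}Z_{\rho_4(U_4)}Z_{\rho_5(U_5)} .$$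
   Context: For a finite set $S$, $S^*$ is the set of words in $S$ (including the empty word $\emptyset$, identified with $1$). $k\langle\langle X_0,X_1\rangle\rangle$ is the ring of non-commutative formal power series; its coproduct is the continuous algebra morphism with $\Delta(X_i)=X_i\otimes1+1\otimes X_i$, and $\Phi$ is group-like if $\Delta(\Phi)=\Phi\hat\otimes\Phi$; in particular $Z_\emptyset=1$. $\Phi(A,B)$ denotes the substitution $X_0\mapsto A$, $X_1\mapsto B$. $U\mathfrak B_5$ is the quotient of $k\langle\langle X_{ij}\rangle\rangle$ ($1\le i,j\le5$) by the relations $X_{ii}=0$; $X_{ij}=X_{ji}$; $\sum_{j=1}^5X_{ij}=0$ for each $i$; $[X_{ij},X_{kl}]=0$ if $\{i,j\}\cap\{k,l\}=\emptyset$. It is the completion, with respect to the ideal generated by the $X_{ij}$, of the graded algebra $k\langle X_{ij}\rangle/\mathcal R$ given by the same generators and relations. A basis $B$ of $U\mathfrak B_5$ means a vector space basis of $k\langle X_{ij}\rangle/\mathcal R$ consisting of homogeneous elements, such that every $\Psi\in U\mathfrak B_5$ can be uniquely written as a series $\sum_{b\in B}a_b b$; its degree $0$ element is $1$. For each $W$ only finitely many $l_{b,W}$ are nonzero, and for each $b$ only finitely many $l_{b,W}$ are nonzero. $\rho_1,\ldots,\rho_5$ are the multiplicative maps from words in $X_{12},X_{23},X_{34},X_{45},X_{24}$ to $\{X_0,X_1\}^*\cup\{0\}$ with $\rho_i(\emptyset)=1$ and, on letters: $\rho_1$: $X_{12}\mapsto X_0$, $X_{23}\mapsto X_1$, $X_{34},X_{45},X_{24}\mapsto0$;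 $\rho_2$: $X_{34}\mapsto X_0$, $X_{45}\mapsto X_1$, $X_{12},X_{23},X_{24}\mapsto0$; $\rho_3$: $X_{12}\mapsto X_1$, $X_{23},X_{34},X_{24}\mapsto X_0$, $X_{45}\mapsto0$; $\rho_4$: $X_{23}\mapsto X_0$, $X_{34}\mapsto X_1$, $X_{12},X_{45},X_{24}\mapsto0$; $\rho_5$: $X_{45}\mapsto X_0$, $X_{23},X_{34},X_{24}\mapsto X_1$, $X_{12}\mapsto0$. Convention: $Z_0=0$ and $Z_1=Z_\emptyset=1$. *)

(* Defs.v *)
From HB Require Import structures.
From mathcomp Require Import all_boot all_order all_algebra.
From mathcomp Require Import boolp classical_sets functions cardinality fsbigop.

Set Implicit Arguments.
Unset Strict Implicit.
Unset Printing Implicit Defensive.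

Import GRing.Theory.
Local Open Scope ring_scope.
Local Open Scope classical_set_scope.
Local Open Scope quotient_scope.

(* R<<S>>: the series f stands for the sum of the [f w] w over the words w. *)
Definition ncseries (R : nzRingType) (S : choiceType) : Type := seq S -> R.

Section NCSeries.
Variables (R : nzRingType) (S : choiceType).
Implicit Types f g h : ncseries R S.

HB.instance Definition _ := GRing.Zmodule.copy (ncseries R S) (seq S -> R).

Definition nc1 : ncseries R S := fun w => (size w == 0)%:R.

Definition ncmul f g : ncseries R S := fun w =>
  \sum_(i < (size w).+1) f (take i w) * g (drop i w).

Lemma ncaddE f g w : (f + g) w = f w + g w. Proof. by []. Qed.

Lemma ncmulA : associative ncmul.
Proof.
move=> f g h; apply/funext => w; rewrite /ncmul.
under eq_bigr => i _ do rewrite big_distrr /=.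
under [RHS]eq_bigr => i _ do rewrite big_distrl /=.
pose F i j := f (take i w) * (g (take j (drop i w)) * h (drop (i + j) w)).
transitivity (\sum_(0 <= i < (size w).+1)
    \sum_(i <= m < (size w).+1) F i (m - i)%N).
  rewrite big_mkord; apply: eq_bigr => i _.
  have le_iw : (i <= size w)%N by rewrite -ltnS.
  have := @big_addn _ 0 +%R 0 (size w).+1 i xpredT (fun m => F i (m - i)%N).
  rewrite add0n => ->; rewrite subSn// size_drop big_mkord.
  by apply: eq_bigr => j _; rewrite /F drop_drop addnK addnC.
transitivity (\sum_(0 <= i < (size w).+1)
    \sum_(0 <= m < (size w).+1 | (i <= m)%N) F i (m - i)%N).
  by apply: eq_bigr => i _; rewrite (@big_nat_widenl _ _ _ i 0).
rewrite (exchange_big_dep_nat xpredT)//= big_mkord; apply: eq_bigr => m _.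
have le_mw : (m <= size w)%N by rewrite -ltnS.
rewrite size_takel// -(big_mkord xpredT (fun i => f (take i (take m w)) *
  g (drop i (take m w)) * h (drop m w))).
rewrite [RHS](@big_nat_widen _ _ _ _ _ (size w).+1)//.
apply: eq_big => [i|i le_im]; first by rewrite ltnS.
by rewrite /F subnKC// -mulrA take_takel// take_drop subnK.
Qed.

Lemma ncmul1f : left_id nc1 ncmul.
Proof.
move=> f; apply/funext => w; rewrite /ncmul big_ord_recl big1 /=.
  by rewrite addr0 take0 /nc1 eqxx mul1r drop0.
by move=> i _; rewrite /nc1 size_takel ?mul0r//; exact: ltn_ord.
Qed.

Lemma ncmulf1 : right_id nc1 ncmul.
Proof.
move=> f; apply/funext => w; rewrite /ncmul big_ord_recr big1 /=.
  by rewrite add0r drop_size /nc1 eqxx mulr1 take_size.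
by move=> i _; rewrite /nc1 size_drop subn_eq0 leqNgt ltn_ord mulr0.
Qed.

Lemma ncmulDl : left_distributive ncmul +%R.
Proof.
move=> f g h; apply/funext => w; rewrite ncaddE /ncmul -big_split /=.
by apply: eq_bigr => i _; rewrite ncaddE mulrDl.
Qed.

Lemma ncmulDr : right_distributive ncmul +%R.
Proof.
move=> f g h; apply/funext => w; rewrite ncaddE /ncmul -big_split /=.
by apply: eq_bigr => i _; rewrite ncaddE mulrDr.
Qed.

Lemma nc1_neq0 : nc1 != 0.
Proof.
apply/eqP => /(congr1 (fun f : ncseries R S => f [::])).
by rewrite /nc1 eqxx => /eqP; rewrite oner_eq0.
Qed.

HB.instance Definition _ := GRing.Zmodule_isNzRing.Build (ncseries R S)
  ncmulA ncmul1f ncmulf1 ncmulDl ncmulDr nc1_neq0.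

Lemma ncmulE f g w :
  (f * g) w = \sum_(i < (size w).+1) f (take i w) * g (drop i w).
Proof. by []. Qed.

Definition ncscale (a : R) f : ncseries R S := fun w => a * f w.

Lemma ncscaleA a b f : ncscale a (ncscale b f) = ncscale (a * b) f.
Proof. by apply/funext => w; rewrite /ncscale mulrA. Qed.

Lemma ncscale1 : left_id 1 ncscale.
Proof. by move=> f; apply/funext => w; rewrite /ncscale mul1r. Qed.

Lemma ncscaleDr : right_distributive ncscale +%R.
Proof. by move=> a f g; apply/funext => w; rewrite /ncscale mulrDr. Qed.

Lemma ncscaleDl f : {morph ncscale^~ f : a b / a + b}.
Proof. by move=> a b; apply/funext => w; rewrite /ncscale mulrDl. Qed.

HB.instance Definition _ := GRing.Zmodule_isLmodule.Build R (ncseries R S)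
  ncscaleA ncscale1 ncscaleDr ncscaleDl.

Lemma ncscaleAl a f g : a *: (f * g) = (a *: f) * g.
Proof.
apply/funext => w; rewrite ncmulE; transitivity (a * (f * g) w) => //.
rewrite ncmulE big_distrr.
by apply: eq_bigr => i _ /=; rewrite mulrA.
Qed.

HB.instance Definition _ :=
  GRing.Lmodule_isLalgebra.Build R (ncseries R S) ncscaleAl.

Definition ncvar (x : S) : ncseries R S := fun w => (w == [:: x])%:R.

Definition is_ncpoly f := finite_set [set w | f w != 0].

Definition ncsupported_in (n : nat) f := forall w, f w != 0 -> size w = n.

Definition nc_order_ge (N : nat) f := forall w, (size w < N)%N -> f w = 0.

End NCSeries.
Arguments ncvar {R S} x.

(* The sum of the Phi_W W(a), W(a) being W with each letter x replaced by
   a x.  Coefficient by coefficient, this is a sum with finite support as soon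
   as the a x have zero constant coefficients. *)
Definition ncsubst (k : fieldType) (S T : choiceType) (Phi : ncseries k S)
    (a : S -> ncseries k T) : ncseries k T := fun w =>
  \sum_(W \in [set: seq S]) Phi W * (\prod_(x <- W) a x) w.

(* The completed tensor square of k<<S>>, encoded as series in S with
   coefficients in k<<S>>: [f u v] is the coefficient of u ⊗ v.  Coefficients
   commute with the outer variables, so that the product of u ⊗ v and u' ⊗ v'
   is uu' ⊗ vv'. *)
Definition nctensor2 (k : fieldType) (S : choiceType) : Type :=
  ncseries (ncseries k S) S.

HB.instance Definition _ (k : fieldType) (S : choiceType) :=
  GRing.NzRing.on (nctensor2 k S).

Definition nctens (k : fieldType) (S : choiceType) (f g : ncseries k S) :
  nctensor2 k S := fun u v => f u * g v.

(* The coefficient of u ⊗ v in the coproduct of W vanishes unless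
   size W = size u + size v, hence the sum has finite support. *)
Definition nccoprod (k : fieldType) (S : choiceType) (f : ncseries k S) :
    nctensor2 k S := fun u v =>
  \sum_(W \in [set: seq S]) f W *
    (\prod_(x <- W) (nctens (ncvar x) 1 + nctens 1 (ncvar x))) u v.

(* The normalization only excludes Phi = 0. *)
Definition group_like (k : fieldType) (S : choiceType) (Phi : ncseries k S) :=
  Phi [::] = 1 /\ nccoprod Phi = nctens Phi Phi.

Inductive ideal_span (A : nzRingType) (P : A -> Prop) : A -> Prop :=
| ideal_span_gen f : P f -> ideal_span P f
| ideal_span0 : ideal_span P 0
| ideal_spanD f g : ideal_span P f -> ideal_span P g -> ideal_span P (f + g)
| ideal_spanMl a f : ideal_span P f -> ideal_span P (a * f)
| ideal_spanMr f a : ideal_span P f -> ideal_span P (f * a).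

(* The point i of {1, ..., 5} is the ordinal of value i - 1. *)
Definition p1 : 'I_5 := @Ordinal 5 0 isT.
Definition p2 : 'I_5 := @Ordinal 5 1 isT.
Definition p3 : 'I_5 := @Ordinal 5 2 isT.
Definition p4 : 'I_5 := @Ordinal 5 3 isT.
Definition p5 : 'I_5 := @Ordinal 5 4 isT.

Section UB5.
Variable k : fieldType.

Definition series5 : Type := ncseries k ('I_5 * 'I_5)%type.
HB.instance Definition _ := GRing.Lalgebra.on series5.

Definition Xs (i j : 'I_5) : series5 := ncvar (i, j).

Inductive UB5_relator : series5 -> Prop :=
| UB5_diag i : UB5_relator (Xs i i)
| UB5_sym i j : UB5_relator (Xs i j - Xs j i)
| UB5_sum i : UB5_relator (\sum_(j < 5) Xs i j)
| UB5_comm i j m n : [set i; j] `&` [set m; n] = set0 ->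
    UB5_relator (Xs i j * Xs m n - Xs m n * Xs i j).

(* The closure, in the topology given by the powers of the augmentation ideal,
   of the two-sided ideal generated by the relators: dividing by the closure
   makes the quotient complete and separated. *)
Definition UB5_ideal (f : series5) := forall N : nat,
  exists2 g, ideal_span UB5_relator g & nc_order_ge N (f - g).

Lemma UB5_ideal0 : UB5_ideal 0.
Proof. by move=> N; exists 0; [exact: ideal_span0 | rewrite subrr]. Qed.

Lemma UB5_idealD f g : UB5_ideal f -> UB5_ideal g -> UB5_ideal (f + g).
Proof.
move=> If Ig N; have [f' If' ff'] := If N; have [g' Ig' gg'] := Ig N.
exists (f' + g'); first exact: ideal_spanD.
by move=> w wN; rewrite opprD addrACA ncaddE ff'// gg'// addr0.
Qed.

Lemma nc_orderMl N (a f : series5) : nc_order_ge N f -> nc_order_ge N (a * f).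
Proof.
move=> fN w wN; apply: big1 => i _; rewrite fN ?mulr0//.
by rewrite size_drop (leq_ltn_trans (leq_subr _ _)).
Qed.

Lemma nc_orderMr N (a f : series5) : nc_order_ge N f -> nc_order_ge N (f * a).
Proof.
move=> fN w wN; apply: big1 => i _; rewrite fN ?mul0r//.
by rewrite size_take_min (leq_ltn_trans (geq_minr _ _)).
Qed.

Lemma UB5_idealMl a f : UB5_ideal f -> UB5_ideal (a * f).
Proof.
move=> If N; have [g Ig fg] := If N; exists (a * g); first exact: ideal_spanMl.
by rewrite -mulrBr; exact: nc_orderMl.
Qed.

Lemma UB5_idealMr f a : UB5_ideal f -> UB5_ideal (f * a).
Proof.
move=> If N; have [g Ig fg] := If N; exists (g * a); first exact: ideal_spanMr.
by rewrite -mulrBl; exact: nc_orderMr.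
Qed.

Lemma UB5_idealN f : UB5_ideal f -> UB5_ideal (- f).
Proof. by move=> If; rewrite -mulN1r; exact: UB5_idealMl. Qed.

Lemma UB5_idealZ (a : k) f : UB5_ideal f -> UB5_ideal (a *: f).
Proof. by move=> If; rewrite -[f]mul1r scalerAl; exact: UB5_idealMl. Qed.

Definition UB5_eqv (f g : series5) : bool := `[< UB5_ideal (f - g) >].

Lemma UB5_eqv_refl : reflexive UB5_eqv.
Proof. by move=> f; apply/asboolP; rewrite subrr; exact: UB5_ideal0. Qed.

Lemma UB5_eqv_sym : symmetric UB5_eqv.
Proof.
by move=> f g; apply/asboolP/asboolP => /UB5_idealN; rewrite opprB.
Qed.

Lemma UB5_eqv_trans : transitive UB5_eqv.
Proof.
move=> g f h /asboolP fg /asboolP gh; apply/asboolP.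
by rewrite -(subrKA g); exact: UB5_idealD.
Qed.

Canonical UB5_equiv := EquivRel UB5_eqv UB5_eqv_refl UB5_eqv_sym UB5_eqv_trans.

Definition UB5 : Type := {eq_quot UB5_equiv}.
HB.instance Definition _ := Choice.on UB5.
HB.instance Definition _ := EqQuotient.on UB5.

Definition UB5_pi : series5 -> UB5 := \pi_UB5.

Lemma UB5_piP f g : UB5_pi f = UB5_pi g <-> UB5_ideal (f - g).
Proof.
split; first by move=> /eqP; rewrite eqmodE => /asboolP.
by move=> fg; apply/eqP; rewrite eqmodE; apply/asboolP.
Qed.

Lemma UB5_reprK x : UB5_pi (repr x) = x. Proof. exact: reprK. Qed.

Lemma UB5_reprP f : UB5_ideal (repr (UB5_pi f) - f).
Proof. by apply/UB5_piP; rewrite UB5_reprK. Qed.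

Definition UB5_add (x y : UB5) : UB5 := UB5_pi (repr x + repr y).
Definition UB5_opp (x : UB5) : UB5 := UB5_pi (- repr x).
Definition UB5_mul (x y : UB5) : UB5 := UB5_pi (repr x * repr y).
Definition UB5_scale (a : k) (x : UB5) : UB5 := UB5_pi (a *: repr x).

Lemma UB5_piD f g : UB5_pi (f + g) = UB5_add (UB5_pi f) (UB5_pi g).
Proof.
apply/esym/UB5_piP; rewrite opprD addrACA.
by apply: UB5_idealD; exact: UB5_reprP.
Qed.

Lemma UB5_piN f : UB5_pi (- f) = UB5_opp (UB5_pi f).
Proof.
by apply/esym/UB5_piP; rewrite -opprD; apply: UB5_idealN; exact: UB5_reprP.
Qed.

Lemma UB5_piM f g : UB5_pi (f * g) = UB5_mul (UB5_pi f) (UB5_pi g).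
Proof.
apply/esym/UB5_piP; set f' := repr _; set g' := repr _.
have -> : f' * g' - f * g = (f' - f) * g' + f * (g' - g).
  by rewrite mulrBl mulrBr subrKA.
by apply: UB5_idealD; [apply: UB5_idealMr | apply: UB5_idealMl]; exact: UB5_reprP.
Qed.

Lemma UB5_piZ a f : UB5_pi (a *: f) = UB5_scale a (UB5_pi f).
Proof.
by apply/esym/UB5_piP; rewrite -scalerBr; apply: UB5_idealZ; exact: UB5_reprP.
Qed.

Lemma UB5_addA : associative UB5_add.
Proof.
by move=> x y z; rewrite -(UB5_reprK x) -(UB5_reprK y) -(UB5_reprK z)
  -!UB5_piD addrA.
Qed.

Lemma UB5_addC : commutative UB5_add.
Proof. by move=> x y; rewrite /UB5_add addrC. Qed.

Lemma UB5_add0 : left_id (UB5_pi 0) UB5_add.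
Proof. by move=> x; rewrite -(UB5_reprK x) -UB5_piD add0r. Qed.

Lemma UB5_addN : left_inverse (UB5_pi 0) UB5_opp UB5_add.
Proof. by move=> x; rewrite -(UB5_reprK x) -UB5_piN -UB5_piD addNr. Qed.

HB.instance Definition _ :=
  GRing.isZmodule.Build UB5 UB5_addA UB5_addC UB5_add0 UB5_addN.

Lemma UB5_mulA : associative UB5_mul.
Proof.
by move=> x y z; rewrite -(UB5_reprK x) -(UB5_reprK y) -(UB5_reprK z)
  -!UB5_piM mulrA.
Qed.

Lemma UB5_mul1x : left_id (UB5_pi 1) UB5_mul.
Proof. by move=> x; rewrite -(UB5_reprK x) -UB5_piM mul1r. Qed.

Lemma UB5_mulx1 : right_id (UB5_pi 1) UB5_mul.
Proof. by move=> x; rewrite -(UB5_reprK x) -UB5_piM mulr1. Qed.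

Lemma UB5_mulDl : left_distributive UB5_mul UB5_add.
Proof.
move=> x y z; rewrite -(UB5_reprK x) -(UB5_reprK y) -(UB5_reprK z).
by rewrite -UB5_piD -UB5_piM mulrDl UB5_piD !UB5_piM.
Qed.

Lemma UB5_mulDr : right_distributive UB5_mul UB5_add.
Proof.
move=> x y z; rewrite -(UB5_reprK x) -(UB5_reprK y) -(UB5_reprK z).
by rewrite -UB5_piD -UB5_piM mulrDr UB5_piD !UB5_piM.
Qed.

HB.instance Definition _ := GRing.Zmodule_isPzRing.Build UB5
  UB5_mulA UB5_mul1x UB5_mulx1 UB5_mulDl UB5_mulDr.

Lemma UB5_scaleA a b x : UB5_scale a (UB5_scale b x) = UB5_scale (a * b) x.
Proof. by rewrite -(UB5_reprK x) -!UB5_piZ scalerA. Qed.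

Lemma UB5_scale1 : left_id 1 UB5_scale.
Proof. by move=> x; rewrite -(UB5_reprK x) -!UB5_piZ scale1r. Qed.

Lemma UB5_scaleDr : right_distributive UB5_scale UB5_add.
Proof.
move=> a x y; rewrite -(UB5_reprK x) -(UB5_reprK y).
by rewrite -UB5_piD -!UB5_piZ -UB5_piD scalerDr.
Qed.

Lemma UB5_scaleDl x : {morph UB5_scale^~ x : a b / a + b >-> UB5_add a b}.
Proof.
by move=> a b; rewrite -(UB5_reprK x) -!UB5_piZ -UB5_piD scalerDl.
Qed.

HB.instance Definition _ := GRing.Zmodule_isLmodule.Build k UB5
  UB5_scaleA UB5_scale1 UB5_scaleDr UB5_scaleDl.

Lemma UB5_pi_zmod_morphism : zmod_morphism UB5_pi.
Proof. by move=> f g; rewrite UB5_piD UB5_piN. Qed.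

HB.instance Definition _ :=
  GRing.isZmodMorphism.Build series5 UB5 UB5_pi UB5_pi_zmod_morphism.

Lemma UB5_pi_monoid_morphism : monoid_morphism UB5_pi.
Proof. by split=> // f g; rewrite UB5_piM. Qed.

HB.instance Definition _ :=
  GRing.isMonoidMorphism.Build series5 UB5 UB5_pi UB5_pi_monoid_morphism.

Definition UB5_X (i j : 'I_5) : UB5 := UB5_pi (Xs i j).

Definition UB5_homog (n : nat) : set UB5 := UB5_pi @` @ncsupported_in _ _ n.

(* The image of k<X_ij>.  The relators being homogeneous, it is the graded
   algebra k<X_ij> / R, see [ncpoly_UB5_ideal] below. *)
Definition UB5_poly : set UB5 := UB5_pi @` @is_ncpoly _ _.

Definition UB5_filt (N : nat) : set UB5 := UB5_pi @` @nc_order_ge _ _ N.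

Definition is_lincomb (B : set UB5) (a : UB5 -> k) (x : UB5) :=
  finite_set (B `&` [set b | a b != 0]) /\ x = \sum_(b \in B) a b *: b.

Definition is_seriescomb (B : set UB5) (a : UB5 -> k) (x : UB5) :=
  forall N : nat, exists D : set UB5, [/\ finite_set D, D `<=` B &
    forall E : set UB5, finite_set E -> D `<=` E -> E `<=` B ->
      UB5_filt N (x - \sum_(b \in E) a b *: b)].

Record UB5_basis (B : set UB5) : Prop := {
  UB5_basis_homog : forall b, B b -> exists n, UB5_homog n b;
  UB5_basis_span : forall x, UB5_poly x -> exists a, is_lincomb B a x;
  UB5_basis_free : forall a, is_lincomb B a 0 -> forall b, B b -> a b = 0;
  UB5_basis_series : forall x, exists a, is_seriescomb B a x /\
    forall a', is_seriescomb B a' x -> forall b, B b -> a' b = a b;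
  UB5_basis_deg0 : B `&` UB5_homog 0 = [set 1] }.

(* The letters of words in X_0, X_1: [false] is X_0 and [true] is X_1. *)
Definition Phi_at (Phi : ncseries k bool) (a b : series5) : series5 :=
  ncsubst Phi (fun x : bool => if x then b else a).

Definition pentagon (Phi : ncseries k bool) :=
  UB5_pi (Phi_at Phi (Xs p1 p2) (Xs p2 p3)) *
  UB5_pi (Phi_at Phi (Xs p3 p4) (Xs p4 p5)) *
  UB5_pi (Phi_at Phi (Xs p5 p1) (Xs p1 p2)) *
  UB5_pi (Phi_at Phi (Xs p2 p3) (Xs p3 p4)) *
  UB5_pi (Phi_at Phi (Xs p4 p5) (Xs p5 p1)) = 1.

End UB5.

Inductive letter5 := L34 | L45 | L24 | L12 | L23.

Definition letter5_ord (x : letter5) : 'I_5 :=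
  match x with L34 => p1 | L45 => p2 | L24 => p3 | L12 => p4 | L23 => p5 end.
Definition letter5_of_ord (i : 'I_5) : letter5 := nth L34 [:: L34; L45; L24; L12; L23] i.
Lemma letter5_ordK : cancel letter5_ord letter5_of_ord. Proof. by case. Qed.
HB.instance Definition _ := Finite.copy letter5 (can_type letter5_ordK).

Definition X5 (k : fieldType) (x : letter5) : UB5 k :=
  match x with
  | L34 => UB5_X k p3 p4 | L45 => UB5_X k p4 p5 | L24 => UB5_X k p2 p4
  | L12 => UB5_X k p1 p2 | L23 => UB5_X k p2 p3
  end.

Definition word5 (k : fieldType) (W : seq letter5) : UB5 k := \prod_(x <- W) X5 k x.

(* [None] stands for 0. *)
Definition rho1 (x : letter5) : option bool :=
  match x with
  | L12 => Some false | L23 => Some true | L34 | L45 | L24 => None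
  end.
Definition rho2 (x : letter5) : option bool :=
  match x with
  | L34 => Some false | L45 => Some true | L12 | L23 | L24 => None
  end.
Definition rho3 (x : letter5) : option bool :=
  match x with
  | L12 => Some true | L23 | L34 | L24 => Some false | L45 => None
  end.
Definition rho4 (x : letter5) : option bool :=
  match x with
  | L23 => Some false | L34 => Some true | L12 | L45 | L24 => None
  end.
Definition rho5 (x : letter5) : option bool :=
  match x with
  | L45 => Some false | L23 | L34 | L24 => Some true | L12 => None
  end.

(* The multiplicative extension to words, [None] being absorbing. *)
Fixpoint rho_word (rho : letter5 -> option bool) (W : seq letter5) :
    option (seq bool) :=
  if W is x :: W' then
    if (rho x, rho_word rho W') is (Some y, Some V) then Some (y :: V) else None
  else Some [::].

Definition Zcoef (k : fieldType) (Phi : ncseries k bool) (V : option (seq bool)) : k :=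
  if V is Some V' then Phi V' else 0.

Definition C5 (k : fieldType) (Phi : ncseries k bool) (W : seq letter5) : k :=
  \sum_(U \in [set U : seq letter5 * seq letter5 * seq letter5 * seq letter5 *
                       seq letter5 |
               let: (U1, U2, U3, U4, U5) := U in U1 ++ U2 ++ U3 ++ U4 ++ U5 = W])
    let: (U1, U2, U3, U4, U5) := U in
    Zcoef Phi (rho_word rho1 U1) * Zcoef Phi (rho_word rho2 U2) *
    Zcoef Phi (rho_word rho3 U3) * Zcoef Phi (rho_word rho4 U4) *
    Zcoef Phi (rho_word rho5 U5).

(* The two-sided ideal of k<X_ij> generated by the relators. *)
Inductive UB5_poly_ideal (k : fieldType) : series5 k -> Prop :=
| UB5_pideal_gen f : UB5_relator f -> UB5_poly_ideal f
| UB5_pideal0 : UB5_poly_ideal 0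
| UB5_pidealD f g : UB5_poly_ideal f -> UB5_poly_ideal g -> UB5_poly_ideal (f + g)
| UB5_pidealMl a f : is_ncpoly a -> UB5_poly_ideal f -> UB5_poly_ideal (a * f)
| UB5_pidealMr f a : is_ncpoly a -> UB5_poly_ideal f -> UB5_poly_ideal (f * a).

Section Homogeneous.
Variables (k : fieldType) (S : finType).
Implicit Types f g : ncseries k S.

Definition nccomp (n : nat) f : ncseries k S :=
  fun w => if size w == n then f w else 0.

Lemma ncsumE (I : Type) (r : seq I) (P : pred I) (F : I -> ncseries k S) w :
  (\sum_(i <- r | P i) F i) w = \sum_(i <- r | P i) F i w.
Proof. exact: (big_morph (fun f : ncseries k S => f w)). Qed.

Lemma nccompD n f g : nccomp n (f + g) = nccomp n f + nccomp n g.
Proof.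
apply/funext => w; rewrite ncaddE /nccomp ncaddE.
by case: ifP => // _; rewrite addr0.
Qed.

Lemma nccomp_poly n f : is_ncpoly (nccomp n f).
Proof.
apply: (@sub_finite_set _ _ (range (@tval n S))).
  move=> w /=; rewrite /nccomp; case: ifP => [wn _|]; last by rewrite eqxx.
  by exists (Tuple wn).
by apply: finite_image; exact: finite_finset.
Qed.

Lemma nccomp_supported d n f : ncsupported_in d f ->
  nccomp n f = if n == d then f else 0.
Proof.
move=> fd; apply/funext => w; rewrite /nccomp.
have [fw|fw] := eqVneq (f w) 0; last first.
  by rewrite (fd _ fw) eq_sym; case: ifP.
by rewrite fw if_same; case: ifP; rewrite ?fw.
Qed.

Lemma nccompM n f g :
  nccomp n (f * g) = \sum_(i < n.+1) nccomp i f * nccomp (n - i) g.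
Proof.
apply/funext => w; rewrite ncsumE /nccomp.
under [RHS]eq_bigr => i _ do rewrite ncmulE.
case: eqP => [wn|wn]; last first.
  rewrite big1// => i _; apply: big1 => j _; rewrite size_drop size_takel -1?ltnS//.
  have [ji|_] := eqVneq (j : nat) i; last by rewrite mul0r.
  have [wi|_] := eqVneq (size w - j)%N (n - i)%N; last by rewrite mulr0.
  case: wn; have jw : (j <= size w)%N by rewrite -ltnS.
  have im : (i <= n)%N by rewrite -ltnS.
  by rewrite -(subnK jw) wi ji subnK.
rewrite ncmulE wn; apply: eq_bigr => i _.
have szt (j : 'I_n.+1) : size (take j w) = j.
  by rewrite size_takel// wn -ltnS.
rewrite (bigD1 i)//= big1 ?addr0 => [|j ji].
  by rewrite szt size_drop wn !eqxx.
by rewrite szt; move: ji; rewrite -val_eqE /= => /negbTE ->; rewrite mul0r.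
Qed.

End Homogeneous.

Section PolyIdeal.
Variable k : fieldType.
Implicit Types f g : series5 k.

Lemma UB5_relator_supported f : UB5_relator f -> exists d, ncsupported_in d f.
Proof.
have X1 i j w : Xs k i j w != 0 -> size w = 1.
  by rewrite /Xs /ncvar; case: (w =P [:: (i, j)]) => [->//|_]; rewrite eqxx.
have X2 i j m n w : (Xs k i j * Xs k m n) w != 0 -> size w = 2.
  apply: contra_neq_eq => w2; apply: big1 => a _.
  have [->|/X1 sa] := eqVneq (Xs k i j (take a w)) 0; first by rewrite mul0r.
  have [->|/X1 sd] := eqVneq (Xs k m n (drop a w)) 0; first by rewrite mulr0.
  have := congr1 size (cat_take_drop a w); rewrite size_cat sa sd => w2'.
  by rewrite -w2' in w2.
case=> [i|i j|i|i j m n _].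
- by exists 1; exact: X1.
- exists 1 => w; apply: contra_neq_eq => w1.
  have XE a b : Xs k a b w = 0 by apply: contra_neq_eq w1 => /X1.
  by rewrite ncaddE XE add0r -[LHS]/(- (Xs k j i w)) XE oppr0.
- exists 1 => w; apply: contra_neq_eq => w1; rewrite ncsumE big1// => j _.
  by apply: contra_neq_eq w1 => /X1.
- exists 2 => w; apply: contra_neq_eq => w1.
  have XE a b c d : (Xs k a b * Xs k c d) w = 0.
    by apply: contra_neq_eq w1 => /X2.
  by rewrite ncaddE XE add0r -[LHS]/(- ((Xs k m n * Xs k i j) w)) XE oppr0.
Qed.

Lemma UB5_poly_ideal_sum (n : nat) (F : 'I_n -> series5 k) :
  (forall i, UB5_poly_ideal (F i)) -> UB5_poly_ideal (\sum_(i < n) F i).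
Proof.
by move=> IF; apply: big_ind => //; [exact: UB5_pideal0 | exact: UB5_pidealD].
Qed.

Lemma nccomp_ideal_span n f :
  ideal_span (@UB5_relator k) f -> UB5_poly_ideal (nccomp n f).
Proof.
move=> If; elim: If n => {f} [f Rf|||a f _ IH|f a _ IH] n.
- have [d /nccomp_supported ->] := UB5_relator_supported Rf.
  by case: ifP => _; [exact: UB5_pideal_gen | exact: UB5_pideal0].
- rewrite (_ : nccomp n _ = 0); first exact: UB5_pideal0.
  by apply/funext => w; rewrite /nccomp if_same.
- by move=> g _ IHf _ IHg m; rewrite nccompD; apply: UB5_pidealD.
- rewrite nccompM; apply: UB5_poly_ideal_sum => i.
  by apply: UB5_pidealMl => //; exact: nccomp_poly.
- rewrite nccompM; apply: UB5_poly_ideal_sum => i.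
  by apply: UB5_pidealMr => //; exact: nccomp_poly.
Qed.

Lemma ncpoly_UB5_ideal f : is_ncpoly f -> UB5_ideal f -> UB5_poly_ideal f.
Proof.
move=> /finite_seqP[s fs] If.
pose N := (\max_(w <- s) size w).+1.
have [g Ig fg] := If N.
have -> : f = \sum_(n < N) nccomp n g.
  apply/funext => w; rewrite ncsumE /nccomp.
  have [wN|wN] := ltnP (size w) N.
    rewrite (bigD1 (Ordinal wN))//= eqxx big1 ?addr0 => [|i]; last first.
      by rewrite -val_eqE /= eq_sym => /negbTE ->.
    by apply/eqP; rewrite -subr_eq0; apply/eqP; exact: fg.
  rewrite big1 => [|i _]; last first.
    by rewrite (gtn_eqF (leq_trans (ltn_ord i) wN)).
  apply/eqP; apply: contraTT wN => fw; rewrite -ltnNge ltnS.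
  have ws : w \in s.
    by have : [set w | f w != 0] w by []; rewrite fs.
  by apply: (@leq_bigmax_seq _ _ xpredT size).
by apply: UB5_poly_ideal_sum => i; exact: nccomp_ideal_span.
Qed.

End PolyIdeal.

(* Main.v *)
Require Import Defs.
From HB Require Import structures.
From mathcomp Require Import all_boot all_order all_algebra.
From mathcomp Require Import boolp classical_sets functions cardinality fsbigop.
Set Implicit Arguments.
Unset Strict Implicit.
Unset Printing Implicit Defensive.
Local Open Scope ring_scope.
Local Open Scope classical_set_scope.

Import GRing.Theory.

(** In the completed algebra X51 = X23 + X34 + X24: the row sums of the points
    2, 3, 4 minus those of 1, 5 give twice this relation ([UB5_X51]).  All the
    arguments of the five factors of the pentagon are therefore sums of the five
    letters X34, X45, X24, X12, X23, and expanding the i-th factor as a series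
    in these letters gives the word U the coefficient of Phi at rho_i(U)
    ([eval_deg_relabel]).  Hence the left-hand side of the pentagon is the value
    at the five letters of the product of five series in free variables, and the
    coefficient at W of that product is the sum over the factorizations
    W = U1 ... U5, that is C5 Phi W ([C5_prod], [is_eval_pentagon]).

    It remains to read the sum of the C5 Phi W W in the basis B.  The ideal is
    homogeneous, so a word W of length n only involves elements of B of degree
    n ([lincomb_homog]); each coordinate of the series is then a finite sum, and
    the series expands in B with coordinates the sums of the l b W C5 Phi W
    ([is_eval_seriescomb]).  Expansions in B are unique and, the completion
    being separated, determine their sum ([seriescomb_inj]), so the pentagon
    holds if and only if these coordinates are those of 1.  At b = 1 this is
    automatic: only the empty word contributes, and C5 Phi is 1 there because
    Phi has constant coefficient 1 ([coord1_nil], [C5_nil]).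

    Infinite sums are handled through [is_eval]: a series has value x when its
    truncations approach x in the filtration.  Products of series then have the
    product values because degree n parts multiply by the Cauchy formula
    ([eval_degM], [is_evalM]). *)

(** * Finite sums and words *)

Lemma fsum_seq (V : nmodType) (I : choiceType) (A : set I) (r : seq I)
    (F : I -> V) :
  uniq r -> (forall i, i \in r -> A i) ->
  (forall i, A i -> F i != 0 -> i \in r) ->
  \sum_(i \in A) F i = \sum_(i <- r) F i.
Proof.
move=> ur rA Ar; rewrite (fsbigE r)//; last first.
  by move=> i Ai; apply: contraNeq; exact: Ar.
rewrite big_seq_cond [RHS]big_seq; apply: eq_bigl => i.
by case: (boolP (i \in r)) => //= /rA; apply: mem_set.
Qed.

Fixpoint words (S : finType) (n : nat) : seq (seq S) :=
  if n is m.+1 then [seq x :: w | x <- enum S, w <- words S m] else [:: [::]].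

Lemma words_uniq (S : finType) n : uniq (words S n).
Proof.
elim: n => //= n IH; apply: allpairs_uniq => //; first exact: enum_uniq.
by move=> [x w] [y v] _ _ [-> ->].
Qed.

Lemma mem_words (S : finType) n (w : seq S) : (w \in words S n) = (size w == n).
Proof.
elim: n w => [|n IH] [|x w] //=.
- by apply/negbTE/negP => /allpairsP[[? ?] []].
- rewrite eqSS -IH; apply/allpairsP/idP => [[[y v] /= [_ vn [_ ->]]]//|wn].
  by exists (x, w); rewrite mem_enum.
Qed.

Lemma big_words0 (V : nmodType) (S : finType) (F : seq S -> V) :
  \sum_(w <- words S 0) F w = F [::].
Proof. by rewrite /words big_seq1. Qed.

Lemma big_wordsS (V : nmodType) (S : finType) n (F : seq S -> V) :
  \sum_(w <- words S n.+1) F w = \sum_x \sum_(w <- words S n) F (x :: w).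
Proof. by rewrite /= big_allpairs_dep big_enum. Qed.

Definition words_lt (S : finType) (N : nat) : seq (seq S) :=
  flatten [seq words S n | n <- iota 0 N].

Lemma mem_words_lt (S : finType) N (w : seq S) :
  (w \in words_lt S N) = (size w < N)%N.
Proof.
apply/flatten_mapP/idP => [[n]|wN].
  by rewrite mem_iota mem_words => nN /eqP ->.
by exists (size w); rewrite ?mem_iota ?mem_words.
Qed.

Lemma words_lt_uniq (S : finType) N : uniq (words_lt S N).
Proof.
elim: N => // N IH; rewrite /words_lt -addn1 iotaD map_cat flatten_cat /= cats0.
rewrite cat_uniq IH words_uniq andbT; apply/hasPn => w.
by rewrite mem_words mem_words_lt add0n => /eqP ->; rewrite ltnn.
Qed.

Lemma big_words_lt (V : nmodType) (S : finType) N (F : seq S -> V) :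
  \sum_(w <- words_lt S N) F w = \sum_(n < N) \sum_(w <- words S n) F w.
Proof.
by rewrite big_flatten big_map -[N in iota 0 N]subn0 -/(index_iota 0 N) big_mkord.
Qed.

Lemma fsum_words_lt (V : nmodType) (S : finType) N (F : seq S -> V) :
  (forall w, F w != 0 -> (size w < N)%N) ->
  \sum_(w \in [set: seq S]) F w = \sum_(w <- words_lt S N) F w.
Proof.
move=> FN; apply: fsum_seq; [exact: words_lt_uniq | by [] |].
by move=> w _ /FN; rewrite mem_words_lt.
Qed.

(** * The filtration of the completed algebra *)

Section Filtration.
Variable k : fieldType.
Local Notation UB5 := (UB5 k).
Local Notation series5 := (series5 k).
Local Notation UB5_filt := (@UB5_filt k).
Implicit Types (f g : series5) (x y : UB5).

Lemma UB5_piZE (a : k) f : UB5_pi (a *: f) = a *: UB5_pi f.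
Proof. exact: UB5_piZ. Qed.

Lemma nc_scalerAr (a : k) f g : f * (a *: g) = a *: (f * g).
Proof.
apply/funext => w; rewrite ncmulE; transitivity (a * (f * g) w) => //.
rewrite ncmulE big_distrr; apply: eq_bigr => i _ /=.
by rewrite mulrCA.
Qed.

Lemma UB5_scaleAl (a : k) x y : a *: (x * y) = (a *: x) * y.
Proof.
by rewrite -(UB5_reprK x) -(UB5_reprK y) -UB5_piZE -!rmorphM -UB5_piZE scalerAl.
Qed.

Lemma UB5_scaleAr (a : k) x y : x * (a *: y) = a *: (x * y).
Proof.
rewrite -(UB5_reprK x) -(UB5_reprK y) -UB5_piZE -!rmorphM -UB5_piZE.
by rewrite nc_scalerAr.
Qed.

Lemma UB5_filt0 x : UB5_filt 0 x.
Proof. by exists (repr x); rewrite ?UB5_reprK. Qed.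

Lemma UB5_filt_zero N : UB5_filt N 0.
Proof. by exists 0; rewrite ?rmorph0. Qed.

Lemma UB5_filtW m n x : (m <= n)%N -> UB5_filt n x -> UB5_filt m x.
Proof.
by move=> mn [f fn <-]; exists f => // w wm; apply: fn; exact: leq_trans wm mn.
Qed.

Lemma UB5_filtD N x y : UB5_filt N x -> UB5_filt N y -> UB5_filt N (x + y).
Proof.
move=> [f fN <-] [g gN <-]; exists (f + g); last by rewrite rmorphD.
by move=> w wN; rewrite ncaddE fN// gN// addr0.
Qed.

Lemma UB5_filtZ N a x : UB5_filt N x -> UB5_filt N (a *: x).
Proof.
move=> [f fN <-]; exists (a *: f); last by rewrite UB5_piZE.
by move=> w wN; rewrite -[LHS]/(a * f w) fN// mulr0.
Qed.

Lemma UB5_filtN N x : UB5_filt N x -> UB5_filt N (- x).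
Proof. by rewrite -scaleN1r; exact: UB5_filtZ. Qed.

Lemma UB5_filt_sum N (I : Type) (r : seq I) (P : pred I) (F : I -> UB5) :
  (forall i, P i -> UB5_filt N (F i)) -> UB5_filt N (\sum_(i <- r | P i) F i).
Proof.
by move=> FN; apply: big_ind => //; [exact: UB5_filt_zero | exact: UB5_filtD].
Qed.

Lemma nc_orderM m n f g : nc_order_ge m f -> nc_order_ge n g ->
  nc_order_ge (m + n) (f * g).
Proof.
move=> fm gn w wmn; rewrite ncmulE; apply: big1 => i _.
have iw : (i <= size w)%N by rewrite -ltnS.
have [im|mi] := ltnP i m; first by rewrite fm ?mul0r// size_takel.
rewrite gn ?mulr0// size_drop ltn_subLR//.
by apply: (leq_trans wmn); rewrite leq_add2r.
Qed.

Lemma UB5_filtM m n x y :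
  UB5_filt m x -> UB5_filt n y -> UB5_filt (m + n) (x * y).
Proof.
move=> [f fm <-] [g gn <-]; exists (f * g); last by rewrite rmorphM.
exact: nc_orderM.
Qed.

(** A representative of an element of every step of the filtration is a limit
    of elements of the ideal, hence belongs to it, the ideal being closed. *)
Lemma UB5_separated x : (forall N, UB5_filt N x) -> x = 0.
Proof.
move=> xN; rewrite -(UB5_reprK x) -(rmorph0 (@UB5_pi k)).
apply/UB5_piP; rewrite subr0 => N.
have [f fN fx] := xN N.
have /(_ N)[g Ig fg] : UB5_ideal (repr x - f) by rewrite -UB5_piP fx UB5_reprK.
exists g => // w wN; have := fg w wN.
by rewrite !ncaddE -!/(- f) -[((- f : series5) w)]/(- f w) fN// oppr0 addr0.
Qed.

End Filtration.

(** * Homogeneous components *)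

Section Homogeneous.
Variable k : fieldType.
Local Notation UB5 := (UB5 k).
Local Notation series5 := (series5 k).
Implicit Types (f g : series5) (x y : UB5).

Lemma nccompB n f g : nccomp n (f - g) = nccomp n f - nccomp n g.
Proof.
apply/funext => w; rewrite /nccomp -[in LHS]/(f w - g w).
rewrite -[RHS]/((if _ then _ else _) - (if _ then _ else _) : k).
by case: ifP => // _; rewrite subr0.
Qed.

Lemma nccompZ n (a : k) f : nccomp n (a *: f) = a *: nccomp n f.
Proof.
apply/funext => w; rewrite -[RHS]/(a * nccomp n f w) /nccomp.
by case: ifP => // _; rewrite mulr0.
Qed.

Lemma UB5_poly_ideal_sub f : UB5_poly_ideal f -> ideal_span (@UB5_relator k) f.
Proof.
elim=> {f} [f Rf||f g _ If _ Ig|a f _ _ If|f a _ _ If].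
- exact: ideal_span_gen.
- exact: ideal_span0.
- exact: ideal_spanD.
- exact: ideal_spanMl.
- exact: ideal_spanMr.
Qed.

(** The closed ideal is homogeneous: in degree n a limit of elements of the
    ideal of relators agrees with a close enough term, whose components are in
    the ideal since the relators are homogeneous. *)
Lemma nccomp_UB5_ideal n f : UB5_ideal f -> UB5_ideal (nccomp n f).
Proof.
move=> /(_ n.+1)[g Ig fg] N; exists (nccomp n g).
  exact/UB5_poly_ideal_sub/nccomp_ideal_span.
rewrite -nccompB => w _; rewrite /nccomp; case: eqP => // wn.
by apply: fg; rewrite wn.
Qed.

Definition UB5_comp (n : nat) x : UB5 := UB5_pi (nccomp n (repr x)).

Lemma UB5_comp_pi n f : UB5_comp n (UB5_pi f) = UB5_pi (nccomp n f).
Proof.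
by apply/UB5_piP; rewrite -nccompB; apply/nccomp_UB5_ideal/UB5_reprP.
Qed.

Lemma UB5_comp_zmod_morphism n : zmod_morphism (UB5_comp n).
Proof.
move=> x y; rewrite -(UB5_reprK x) -(UB5_reprK y) -rmorphB !UB5_comp_pi.
by rewrite nccompB rmorphB.
Qed.

HB.instance Definition _ n :=
  GRing.isZmodMorphism.Build UB5 UB5 (UB5_comp n) (@UB5_comp_zmod_morphism n).

Lemma UB5_compZ n a x : UB5_comp n (a *: x) = a *: UB5_comp n x.
Proof.
by rewrite -(UB5_reprK x) -UB5_piZE !UB5_comp_pi nccompZ UB5_piZE.
Qed.

Lemma UB5_comp_homog m n x :
  UB5_homog m x -> UB5_comp n x = if n == m then x else 0.
Proof.
move=> [f fm <-]; rewrite UB5_comp_pi (nccomp_supported n fm).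
by case: ifP => _ //; rewrite rmorph0.
Qed.

Lemma UB5_homog_filt n x : UB5_homog n x -> UB5_filt n x.
Proof.
move=> [f fn <-]; exists f => // w wn.
by apply/eqP; apply: contraTT wn => /fn ->; rewrite ltnn.
Qed.

Lemma ncsupported_inM m n f g :
  ncsupported_in m f -> ncsupported_in n g -> ncsupported_in (m + n) (f * g).
Proof.
move=> fm gn w; apply: contra_neq_eq => wmn; rewrite ncmulE; apply: big1 => i _.
have [->|/fm im] := eqVneq (f (take i w)) 0; first by rewrite mul0r.
have [->|/gn iN] := eqVneq (g (drop i w)) 0; first by rewrite mulr0.
by rewrite -(cat_take_drop i w) size_cat im iN eqxx in wmn.
Qed.

Lemma UB5_homogM m n x y :
  UB5_homog m x -> UB5_homog n y -> UB5_homog (m + n) (x * y).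
Proof.
move=> [f fm <-] [g gn <-]; exists (f * g); last by rewrite rmorphM.
exact: ncsupported_inM.
Qed.

Lemma UB5_homog1 : UB5_homog 0 (1 : UB5).
Proof.
exists 1; last by rewrite rmorph1.
move=> w; rewrite -[(1 : series5) w]/((size w == 0%N)%:R).
by case: (size w) => // n /eqP.
Qed.

Lemma UB5_homog_X i j : UB5_homog 1 (UB5_X k i j).
Proof.
exists (Xs k i j) => // w; rewrite /Xs /ncvar.
by case: (w =P [:: (i, j)]) => [->//|]; rewrite eqxx.
Qed.

Lemma UB5_homog_word5 W : UB5_homog (size W) (word5 k W).
Proof.
rewrite /word5; elim: W => [|x W IH]; first by rewrite big_nil; exact: UB5_homog1.
rewrite big_cons -[size _]/(1 + size W)%N; apply: UB5_homogM => //.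
by case: x; exact: UB5_homog_X.
Qed.

Lemma lincomb_seq (B : set UB5) (a : UB5 -> k) x : is_lincomb B a x ->
  exists s : seq UB5, [/\ uniq s, forall b, b \in s -> B b,
    forall b, B b -> a b != 0 -> b \in s & x = \sum_(b <- s) a b *: b].
Proof.
move=> [/finite_seqP[s Bs] ->].
have sB b : b \in undup s <-> B b /\ a b != 0.
  by rewrite mem_undup; change ([set` s] b <-> B b /\ a b != 0); rewrite -Bs.
exists (undup s); split; first exact: undup_uniq.
- by move=> b /sB[].
- by move=> b Bb ab; apply/sB.
- apply: fsum_seq; first exact: undup_uniq.
  + by move=> b /sB[].
  + move=> b Bb abb; apply/sB; split=> //.
    by apply: contra_neq abb => ->; rewrite scale0r.
Qed.

(** Projecting the expansion to degree n kills its right-hand side when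
    n <> m, and freeness then kills the coefficients in degree n. *)
Lemma lincomb_homog (B : set UB5) (a : UB5 -> k) x m n b : UB5_basis B ->
  is_lincomb B a x -> UB5_homog m x -> B b -> UB5_homog n b -> a b != 0 -> n = m.
Proof.
move=> basisB ax xm Bb bn; apply: contra_neq_eq => /negbTE nm.
pose a' c := if `[< UB5_homog n c >] then a c else 0.
have [s [us sB Bs xs]] := lincomb_seq ax.
suff : is_lincomb B a' 0.
  by move=> /(UB5_basis_free basisB)/(_ _ Bb); rewrite /a' asboolT.
have a'a c : a' c != 0 -> a c != 0.
  by rewrite /a'; case: ifP => // _; rewrite eqxx.
split.
  by apply: sub_finite_set ax.1 => c [Bc /a'a].
rewrite (fsum_seq us) //; last first.
  move=> c Bc a'c; apply: Bs => //; apply: a'a.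
  by apply: contra_neq a'c => ->; rewrite scale0r.
transitivity (UB5_comp n x); first by rewrite (UB5_comp_homog _ xm) nm.
rewrite xs raddf_sum big_seq [RHS]big_seq; apply: eq_bigr => c /sB Bc.
rewrite /= UB5_compZ /a'; have [d cd] := UB5_basis_homog basisB Bc.
case: asboolP => [cn|cn]; first by rewrite (UB5_comp_homog _ cn) eqxx.
rewrite (UB5_comp_homog _ cd) scale0r; case: eqP => [nd|]; last by rewrite scaler0.
by rewrite nd in cn.
Qed.

End Homogeneous.

(** * Convergent evaluation of series *)

Section Evaluation.
Variables (k : fieldType) (S : finType).
Local Notation UB5 := (UB5 k).
Implicit Types (a : S -> UB5) (f g : ncseries k S) (x y : UB5).

Definition eval_deg a (n : nat) f : UB5 :=
  \sum_(w <- words S n) f w *: \prod_(x <- w) a x.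

Definition is_eval a f x :=
  forall N, UB5_filt N (x - \sum_(n < N) eval_deg a n f).

(** The left quotient of a series by a letter is a derivation up to the
    augmentation; it turns the recursion on words into one on series. *)
Definition ncquot (s : S) f : ncseries k S := fun w => f (s :: w).

Lemma eval_deg0 a f : eval_deg a 0 f = f [::] *: (1 : UB5).
Proof. by rewrite /eval_deg big_words0 big_nil. Qed.

Lemma eval_degS a n f :
  eval_deg a n.+1 f = \sum_s a s * eval_deg a n (ncquot s f).
Proof.
rewrite /eval_deg big_wordsS; apply: eq_bigr => s _; rewrite mulr_sumr.
by apply: eq_bigr => w _; rewrite big_cons UB5_scaleAr.
Qed.

Lemma eval_degD a n f g : eval_deg a n (f + g) = eval_deg a n f + eval_deg a n g.
Proof. by rewrite -big_split; apply: eq_bigr => w _; rewrite ncaddE scalerDl. Qed.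

Lemma eval_degZ a n c f : eval_deg a n (c *: f) = c *: eval_deg a n f.
Proof. by rewrite scaler_sumr; apply: eq_bigr => w _; rewrite scalerA. Qed.

Lemma ncquotM s f g : ncquot s (f * g) = ncquot s f * g + f [::] *: ncquot s g.
Proof.
apply/funext => w; rewrite ncaddE.
transitivity (\sum_(i < (size w).+1) ncquot s f (take i w) * g (drop i w) +
  f [::] * g (s :: w)) => //.
by rewrite /ncquot ncmulE big_ord_recl /= addrC.
Qed.

(** Induction on n, generalized over f: the derivation rule for left quotients
    turns degree n + 1 into degree n, and the term with f [::] is the missing
    summand i = 0. *)
Lemma eval_degM a n f g :
  eval_deg a n (f * g) = \sum_(i < n.+1) eval_deg a i f * eval_deg a (n - i) g.
Proof.
elim: n f => [|n IH] f.
  by rewrite big_ord1 !eval_deg0 ncmulE big_ord1 /= -UB5_scaleAl mul1r scalerA.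
rewrite eval_degS big_ord_recl /= eval_deg0 subn0 -UB5_scaleAl mul1r addrC.
under eq_bigr => s _ do rewrite ncquotM eval_degD IH mulrDr.
rewrite big_split /=; congr (_ + _); last first.
  rewrite eval_degS scaler_sumr; apply: eq_bigr => s _.
  by rewrite eval_degZ UB5_scaleAr.
under eq_bigr => s _ do rewrite mulr_sumr.
rewrite exchange_big; apply: eq_bigr => i _.
rewrite eval_degS mulr_suml subSS; apply: eq_bigr => s _; exact: mulrA.
Qed.

Lemma eval_deg_filt a n f : (forall s, UB5_filt 1 (a s)) ->
  UB5_filt n (eval_deg a n f).
Proof.
move=> a1; elim: n f => [|n IH] f; first exact: UB5_filt0.
by rewrite eval_degS; apply: UB5_filt_sum => s _; exact: (@UB5_filtM _ 1 n).
Qed.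

Lemma sum_triangle (V : nmodType) (N : nat) (F : nat -> nat -> V) :
  \sum_(n < N) \sum_(i < n.+1) F i (n - i)%N =
  \sum_(i < N) \sum_(j < N - i) F i j.
Proof.
elim: N => [|N IH]; first by rewrite !big_ord0.
rewrite big_ord_recr /= IH [in RHS]big_ord_recr /= subSnn big_ord1.
rewrite [X in _ + X]big_ord_recr /= subnn addrA -big_split /=; congr (_ + _).
by apply: eq_bigr => i _; rewrite subSn 1?ltnW// big_ord_recr.
Qed.

(** Truncating the second factor at N - i against the degree i part of the
    first one leaves errors of order N, and keeps exactly the terms of total
    degree less than N. *)
Lemma is_evalM a f g x y : (forall s, UB5_filt 1 (a s)) ->
  is_eval a f x -> is_eval a g y -> is_eval a (f * g) (x * y).
Proof.
move=> a1 fx gy N.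
pose p i := eval_deg a i f; pose q j := eval_deg a j g.
have -> : \sum_(n < N) eval_deg a n (f * g) =
    \sum_(i < N) \sum_(j < N - i) p i * q j.
  rewrite -(sum_triangle N (fun i j => p i * q j)).
  by apply: eq_bigr => n _; rewrite eval_degM.
rewrite -(subrK (\sum_(i < N) p i * y) (x * y)) -mulr_suml -mulrBl -addrA.
apply: UB5_filtD.
  by have := UB5_filtM (fx N) (UB5_filt0 y); rewrite addn0.
rewrite mulr_suml -sumrB; apply: UB5_filt_sum => i _.
rewrite -mulr_sumr -mulrBr -[X in UB5_filt X](subnKC (ltnW (ltn_ord i))).
by apply: UB5_filtM; [exact: eval_deg_filt | exact: gy].
Qed.

End Evaluation.

(** * Substitution and relabelling of letters *)

Section Substitution.
Variables (k : fieldType) (S : finType).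
Local Notation UB5 := (UB5 k).
Local Notation series5 := (series5 k).

Lemma nc_order_prod (al : S -> series5) (w : seq S) :
  (forall s, nc_order_ge 1 (al s)) ->
  nc_order_ge (size w) (\prod_(s <- w) al s).
Proof.
move=> al1; elim: w => [|s w IH]; first by [].
by rewrite big_cons; exact: (@nc_orderM k 1 (size w)).
Qed.

(** As the al s have no constant term, words of length at least N do not
    contribute to the coefficients of the substituted series in degree < N. *)
Lemma is_eval_subst (Phi : ncseries k S) (al : S -> series5) :
  (forall s, nc_order_ge 1 (al s)) ->
  is_eval (fun s => UB5_pi (al s)) Phi (UB5_pi (ncsubst Phi al)).
Proof.
move=> al1 N.
have -> : \sum_(n < N) eval_deg (fun s => UB5_pi (al s)) n Phi =
    UB5_pi (\sum_(w <- words_lt S N) Phi w *: \prod_(s <- w) al s).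
  rewrite -big_words_lt rmorph_sum; apply: eq_bigr => w _.
  by rewrite /= UB5_piZE rmorph_prod.
rewrite -rmorphB; eexists; last by [].
move=> v vN; rewrite -[LHS]/(_ v - _ v); apply/eqP; rewrite subr_eq0; apply/eqP.
rewrite ncsumE [LHS](@fsum_words_lt _ _ N)// => w Pw.
apply: leq_ltn_trans vN; rewrite leqNgt; apply: contraNN Pw => vw.
by rewrite (nc_order_prod al1)// mulr0.
Qed.

End Substitution.

Section Relabelling.
Variable k : fieldType.
Local Notation UB5 := (UB5 k).

(** Replacing each y by the sum of the letters of label y expands a word V into
    the sum of the words U with rho(U) = V. *)
Lemma eval_deg_relabel (rho : letter5 -> option bool) (a : letter5 -> UB5)
    (b : bool -> UB5) (n : nat) (Phi : ncseries k bool) :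
  (forall y, b y = \sum_(x | rho x == Some y) a x) ->
  eval_deg a n (fun w => Zcoef Phi (rho_word rho w)) = eval_deg b n Phi.
Proof.
move=> bE; elim: n Phi => [|n IH] Phi; first by rewrite !eval_deg0.
rewrite !eval_degS.
under [RHS]eq_bigr => y _ do rewrite bE mulr_suml big_mkcond.
rewrite exchange_big; apply: eq_bigr => x _ /=.
case rx: (rho x) => [y|]; last first.
  rewrite big1// (_ : ncquot _ _ = 0); last first.
    by apply/funext => w; rewrite /ncquot /= rx.
  by rewrite /eval_deg big1 ?mulr0// => w _; rewrite scale0r.
rewrite (bigD1 y)//= eqxx big1 ?addr0 => [|z zy]; last first.
  by case: eqP => // -[yz]; rewrite yz eqxx in zy.
rewrite -IH; congr (_ * eval_deg _ _ _); apply/funext => w.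
by rewrite /ncquot /= rx; case: (rho_word rho w).
Qed.

End Relabelling.

(** * Linear relations between the generators *)

(** Stated in an abstract abelian group so that the regrouping of the sums is
    independent of the quotient construction: row sums 1 and 5 together equal
    row sums 2, 3 and 4, and x13 + x14 + x12 + x25 + x35 + x45 cancels. *)
Lemma pentagon_row_sums (V : zmodType) (x : 'I_5 -> 'I_5 -> V) :
  (forall i, x i i = 0) -> (forall i j, x i j = x j i) ->
  (forall i, x i p1 + x i p2 + x i p3 + x i p4 + x i p5 = 0) ->
  x p5 p1 *+ 2 = (x p2 p3 + x p3 p4 + x p2 p4) *+ 2.
Proof.
move=> xii xC x0.
have := x0 p5; have := x0 p4; have := x0 p3; have := x0 p2; have := x0 p1.
rewrite !xii (xC p2 p1) (xC p3 p1) (xC p3 p2) (xC p4 p1) (xC p4 p2) (xC p4 p3).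
rewrite (xC p5 p1) (xC p5 p2) (xC p5 p3) (xC p5 p4) !addr0 add0r.
move: (x p1 p2) (x p1 p3) (x p1 p4) (x p1 p5) (x p2 p5) (x p3 p5) (x p4 p5)
  (x p2 p3) (x p2 p4) (x p3 p4) => x12 x13 x14 x15 x25 x35 x45 x23 x24 x34.
move=> s1 s2 s3 s4 s5.
have : (x12 + x13 + x14 + x15) + (x15 + x25 + x35 + x45)
     = (x12 + x23 + x24 + x25) + (x13 + x23 + x34 + x35) + (x14 + x24 + x34 + x45).
  by rewrite s1 s2 s3 s4 s5 !addr0.
rewrite !addrA [LHS](ACl ((4*5)*(1*2*3*6*7*8))).
rewrite [RHS](ACl ((2*7*3)*(6*11*10)*(1*5*9*4*8*12))) /=.
by rewrite !mulr2n => /addIr.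
Qed.

Section Relations.
Variables (k : fieldType) (char_k : [pchar k] =i pred0).
Local Notation UB5 := (UB5 k).
Local Notation X := (UB5_X k).

Lemma UB5_pi_relator f : UB5_relator f -> UB5_pi f = 0 :> UB5.
Proof.
move=> Rf; rewrite -(rmorph0 (@UB5_pi k)); apply/UB5_piP; rewrite subr0 => N.
by exists f; [exact: ideal_span_gen | rewrite subrr].
Qed.

Lemma UB5_Xii i : X i i = 0.
Proof. exact/UB5_pi_relator/UB5_diag. Qed.

Lemma UB5_Xsym i j : X i j = X j i.
Proof.
by apply/eqP; rewrite -subr_eq0 -rmorphB; apply/eqP/UB5_pi_relator/UB5_sym.
Qed.

Lemma UB5_Xsum i : X i p1 + X i p2 + X i p3 + X i p4 + X i p5 = 0.
Proof.
rewrite -(UB5_pi_relator (UB5_sum k i)) rmorph_sum !big_ord_recr big_ord0 /=.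
rewrite add0r.
congr (_ + _ + _ + _ + _); congr (UB5_pi (Xs _ _ _)); exact: val_inj.
Qed.

Lemma UB5_X51 : X p5 p1 = X p2 p3 + X p3 p4 + X p2 p4.
Proof.
have n2 : (2 : k) != 0 by rewrite ((pcharf0P k).1 char_k).
apply: (scalerI n2); rewrite !scaler_nat.
exact: pentagon_row_sums UB5_Xii UB5_Xsym UB5_Xsum.
Qed.

End Relations.

(** * Factorizations of words and products of series *)

Section Factorizations.
Variables (k : fieldType) (S : choiceType).
Implicit Types (f g : ncseries k S) (w : seq S).

Definition splits w : seq (seq S * seq S) :=
  [seq (take i w, drop i w) | i <- iota 0 (size w).+1].

Lemma splits_uniq w : uniq (splits w).
Proof.
rewrite map_inj_in_uniq ?iota_uniq// => i j.
rewrite !mem_iota !ltnS => iw jw.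
by case=> /(congr1 size); rewrite !size_takel.
Qed.

Lemma mem_splits w p : (p \in splits w) = (p.1 ++ p.2 == w).
Proof.
case: p => u v /=; apply/mapP/eqP => [[i _ [-> ->]]|<-]; first exact: cat_take_drop.
exists (size u); last by rewrite take_size_cat ?drop_size_cat.
by rewrite mem_iota /= add0n ltnS size_cat leq_addr.
Qed.

Lemma ncmul_splits f g w : (f * g) w = \sum_(p <- splits w) f p.1 * g p.2.
Proof.
by rewrite ncmulE big_map -[iota 0 _]/(index_iota 0 (size w).+1) big_mkord.
Qed.

(** [f w] is the sum of the [F t] over the finite fibre of c above w, the
    enumeration r being part of the data so that fibres can be composed.  Tuples
    t of words with their concatenation c t are the intended case. *)
Definition factorizes (T : choiceType) (c : T -> seq S) (F : T -> k) f :=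
  exists r : seq S -> seq T, forall w,
    [/\ uniq (r w), forall t, (t \in r w) = (c t == w) &
        f w = \sum_(t <- r w) F t].

Lemma factorizes_id f : factorizes id f f.
Proof.
exists (fun w => [:: w]) => w; split=> // [t|]; last by rewrite big_seq1.
by rewrite mem_seq1.
Qed.

Lemma factorizesM (T : choiceType) (c : T -> seq S) (F : T -> k) f g :
  factorizes c F f ->
  factorizes (fun p : T * seq S => c p.1 ++ p.2) (fun p => F p.1 * g p.2) (f * g).
Proof.
move=> [r rP].
exists (fun w => [seq (t, p.2) | p <- splits w, t <- r p.1]) => w; split.
- apply: allpairs_uniq_dep; first exact: splits_uniq.
    by move=> p _; have [] := rP p.1.
  set st := [seq _ | _ <- _, _ <- _].
  have cst q : q \in st -> c (tagged q) = (tag q).1.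
    case/allpairsPdep => p [t [_ tp ->]] /=.
    by apply/eqP; have [_ <- _] := rP p.1.
  move=> [[u v] t] [[u' v'] t'] /cst /= <- /cst /= <-.
  by move=> [-> ->].
- move=> [t v]; apply/allpairsPdep/eqP => /= [[[u v'] [s]]|ctv].
    rewrite mem_splits => -[/eqP /= <- + [-> ->]].
    by have [_ -> _ /eqP ->] := rP u.
  exists (c t, v), t; rewrite mem_splits ctv eqxx; split=> //=.
  by have [_ -> _] := rP (c t); rewrite eqxx.
- rewrite ncmul_splits big_allpairs_dep; apply: eq_bigr => p _.
  by have [_ _ ->] := rP p.1; rewrite mulr_suml.
Qed.

(** Turns the explicit enumeration into the set-indexed sum used by [C5]. *)
Lemma factorizes_fsum (T : choiceType) (c : T -> seq S) (F : T -> k) f w :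
  factorizes c F f -> \sum_(t \in [set t | c t = w]) F t = f w.
Proof.
move=> [r /(_ w)[ur rw ->]]; apply: fsum_seq => //.
- by move=> t; rewrite rw => /eqP.
- by move=> t /= ctw _; rewrite rw ctw.
Qed.

End Factorizations.

Lemma C5_prod (k : fieldType) (Phi : ncseries k bool) :
  let G rho : ncseries k letter5 := fun U => Zcoef Phi (rho_word rho U) in
  C5 Phi = G rho1 * G rho2 * G rho3 * G rho4 * G rho5.
Proof.
move=> G; apply/funext => W.
have fac := factorizesM (G rho5) (factorizesM (G rho4) (factorizesM (G rho3)
  (factorizesM (G rho2) (factorizes_id (G rho1))))).
rewrite -(factorizes_fsum W fac) /C5.
set A := [set _ | _]; set A' := [set _ | _].
have -> : A = A'.
  by apply/seteqP; split=> -[[[[U1 U2] U3] U4] U5]; rewrite /A /A' /= -!catA.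
by apply: eq_fsbigr => -[[[[U1 U2] U3] U4] U5].
Qed.

(** * Coordinates in a basis *)

Section Coordinates.
Variables (k : fieldType) (B : set (UB5 k)) (basisB : UB5_basis B).
Local Notation UB5 := (UB5 k).

(** Two expansions with the same coordinates have a common finite partial sum
    close to both values. *)
Lemma seriescomb_inj (a : UB5 -> k) x y :
  is_seriescomb B a x -> is_seriescomb B a y -> x = y.
Proof.
move=> ax ay; apply/eqP; rewrite -subr_eq0; apply/eqP/UB5_separated => N.
have [D [finD DB Dx]] := ax N; have [D' [finD' D'B Dy]] := ay N.
have DD'B : D `|` D' `<=` B by rewrite subUset.
have finDD' : finite_set (D `|` D') by rewrite finite_setU.
have := UB5_filtD (Dx _ finDD' (@subsetUl _ _ _) DD'B)
  (UB5_filtN (Dy _ finDD' (@subsetUr _ _ _) DD'B)).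
by rewrite opprB addrA subrK.
Qed.

Lemma seriescomb_ext (a a' : UB5 -> k) x : is_seriescomb B a x ->
  (forall b, B b -> a' b = a b) -> is_seriescomb B a' x.
Proof.
move=> ax aa' N; have [D [finD DB Dx]] := ax N; exists D; split=> // E finE DE EB.
rewrite (_ : \sum_(b \in E) _ = \sum_(b \in E) a b *: b); first exact: Dx.
by apply: eq_fsbigr => b /set_mem /EB Bb; rewrite aa'.
Qed.

Lemma seriescomb1 : is_seriescomb B (fun b => (b == 1)%:R) 1.
Proof.
have B1 : B 1.
  by have [] : (B `&` UB5_homog 0) 1 by rewrite (UB5_basis_deg0 basisB).
move=> N; exists [set 1]; split; [exact: finite_set1 | by move=> _ -> |].
move=> E _ /(_ _ erefl) E1 _.
rewrite (fsum_seq (r := [:: 1]))//.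
- by rewrite big_seq1 eqxx scale1r subrr; exact: UB5_filt_zero.
- by move=> b; rewrite mem_seq1 => /eqP ->.
- move=> b _; rewrite mem_seq1; apply: contraNT => /negbTE ->.
  by rewrite scale0r.
Qed.

Lemma seriescomb_unique (a a' : UB5 -> k) x : is_seriescomb B a x ->
  is_seriescomb B a' x -> forall b, B b -> a b = a' b.
Proof.
move=> ax a'x b Bb; have [c [_ cP]] := UB5_basis_series basisB x.
by rewrite (cP a ax)// (cP a' a'x).
Qed.

Variables (l : UB5 -> seq letter5 -> k).
Hypothesis l_def : forall W : seq letter5, is_lincomb B (l^~ W) (word5 k W).

Lemma word_coord_size b n W : B b -> UB5_homog n b -> l b W != 0 -> size W = n.
Proof.
move=> Bb bn lbW; apply/esym.
exact: (lincomb_homog basisB (l_def W) (UB5_homog_word5 k W) Bb bn lbW).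
Qed.

(** Up to order N the value x is the finite sum of the C W W over the words of
    length less than N.  Expanding these words in B gives the truncated
    coordinates; these are the full ones on basis elements of degree less than
    N, and the other basis elements are in the N-th step of the filtration. *)
Lemma is_eval_seriescomb (C : ncseries k letter5) x : is_eval (X5 k) C x ->
  is_seriescomb B (fun b => \sum_(W \in [set: seq letter5]) l b W * C W) x.
Proof.
move=> Cx N; set a := fun b => _.
(* D collects the basis elements that occur in some word of length < N. *)
pose D := \bigcup_(W in [set` words_lt letter5 N]) (B `&` [set b | l b W != 0]).
exists D; split.
- by apply: bigcup_finite => [|W _]; [exact: finite_seq | exact: (l_def W).1].
- by move=> b [W _ []].
move=> E /finite_seqP[s0 Es0] DE EB.
pose s := undup s0.
have sE b : (b \in s) <-> E b by rewrite mem_undup Es0.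
have us : uniq s by exact: undup_uniq.
rewrite (fsum_seq us); [|by move=> b /sE|by move=> b /sE].
rewrite -(subrK (\sum_(n < N) eval_deg (X5 k) n C) x) -addrA.
apply: UB5_filtD; first exact: Cx.
rewrite -big_words_lt.
have -> : \sum_(W <- words_lt letter5 N) C W *: \prod_(u <- W) X5 k u =
    \sum_(b <- s) (\sum_(W <- words_lt letter5 N) l b W * C W) *: b.
  under [RHS]eq_bigr => b _ do rewrite scaler_suml.
  rewrite exchange_big big_seq [RHS]big_seq; apply: eq_bigr => W WN /=.
  have [_ WE] := l_def W; rewrite -/(word5 k W) WE (fsum_seq us).
  - by rewrite scaler_sumr; apply: eq_bigr => b _; rewrite scalerA mulrC.
  - by move=> b /sE /EB.
  - move=> b Bb lb; apply/sE/DE; exists W => //; split=> //=.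
    by apply: contra_neq lb => ->; rewrite scale0r.
rewrite -sumrB big_seq; apply: UB5_filt_sum => b /sE /EB Bb.
have [n bn] := UB5_basis_homog basisB Bb.
have [nN|Nn] := ltnP n N; last first.
  by rewrite -scalerBl; apply/UB5_filtZ/(UB5_filtW Nn)/UB5_homog_filt.
rewrite /a (fsum_words_lt (N := N)) ?subrr; first exact: UB5_filt_zero.
move=> W lCW; rewrite (word_coord_size Bb bn)//.
by apply: contra_neq lCW => ->; rewrite mul0r.
Qed.

(** Only the empty word contributes, 1 having degree 0, so the sum depends on
    C [::] alone; for the constant series 1 it is the coordinate of 1 on 1. *)
Lemma coord1_nil (C : ncseries k letter5) : C [::] = 1 ->
  \sum_(W \in [set: seq letter5]) l 1 W * C W = 1.
Proof.
move=> C1.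
have B1 : B 1 by have [] : (B `&` UB5_homog 0) 1 by rewrite (UB5_basis_deg0 basisB).
have coord1 (f : ncseries k letter5) :
    \sum_(W \in [set: seq letter5]) l 1 W * f W = l 1 [::] * f [::].
  rewrite (fsum_words_lt (N := 1)) => [|W lfW].
    by rewrite big_words_lt big_ord1 big_words0.
  rewrite (word_coord_size B1 (UB5_homog1 k))//.
  by apply: contra_neq lfW => ->; rewrite mul0r.
have one1 : is_eval (X5 k) 1 1.
  case=> [|N]; first exact: UB5_filt0.
  rewrite big_ord_recl eval_deg0 scale1r big1 ?addr0 ?subrr => [|i _].
    exact: UB5_filt_zero.
  rewrite /eval_deg big_seq big1// => w; rewrite mem_words => /eqP wi.
  by rewrite -[(1 : ncseries _ _) w]/((size w == 0%N)%:R) wi scale0r.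
have := seriescomb_unique (is_eval_seriescomb one1) seriescomb1 B1.
by rewrite !coord1 C1 eqxx.
Qed.

End Coordinates.

(** * The pentagon equation *)

Lemma is_eval_Phi_at (k : fieldType) (Phi : ncseries k bool)
    (rho : letter5 -> option bool) (i j m n : 'I_5) :
  UB5_X k i j = \sum_(x | rho x == Some false) X5 k x ->
  UB5_X k m n = \sum_(x | rho x == Some true) X5 k x ->
  is_eval (X5 k) (fun U => Zcoef Phi (rho_word rho U))
    (UB5_pi (Phi_at Phi (Xs k i j) (Xs k m n))).
Proof.
move=> E0 E1 N.
pose al (y : bool) := if y then Xs k m n else Xs k i j.
have al1 y : nc_order_ge 1 (al y) by case: y => -[|? ?].
rewrite (eq_bigr (fun d : 'I_N => eval_deg (fun y => UB5_pi (al y)) d Phi)).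
  exact: is_eval_subst.
by move=> d _; apply: eval_deg_relabel; case.
Qed.

Lemma big_letter5 (V : nmodType) (P : pred letter5) (F : letter5 -> V) :
  \sum_(x | P x) F x =
  \sum_(x <- [:: L12; L23; L34; L24; L45] | P x) F x.
Proof.
apply: perm_big; apply: uniq_perm => //; first exact: index_enum_uniq.
by move=> x; rewrite mem_index_enum; case: x.
Qed.

Lemma is_eval_pentagon (k : fieldType) (char_k : [pchar k] =i pred0)
    (Phi : ncseries k bool) :
  is_eval (X5 k) (C5 Phi)
    (UB5_pi (Phi_at Phi (Xs k p1 p2) (Xs k p2 p3)) *
     UB5_pi (Phi_at Phi (Xs k p3 p4) (Xs k p4 p5)) *
     UB5_pi (Phi_at Phi (Xs k p5 p1) (Xs k p1 p2)) *
     UB5_pi (Phi_at Phi (Xs k p2 p3) (Xs k p3 p4)) *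
     UB5_pi (Phi_at Phi (Xs k p4 p5) (Xs k p5 p1))).
Proof.
have a1 x : UB5_filt 1 (X5 k x).
  by case: x; apply: UB5_homog_filt; exact: UB5_homog_X.
rewrite C5_prod.
do 4 ?[apply: (is_evalM a1)]; apply: is_eval_Phi_at;
  rewrite big_letter5 !big_cons big_nil /=;
  by rewrite ?addr0 ?(UB5_X51 char_k) ?addrA.
Qed.

Lemma C5_nil (k : fieldType) (Phi : ncseries k bool) :
  Phi [::] = 1 -> C5 Phi [::] = 1.
Proof.
move=> Phi1; rewrite C5_prod.
have M0 (f g : ncseries k letter5) : (f * g) [::] = f [::] * g [::].
  by rewrite ncmulE big_ord1.
by rewrite !M0 /= Phi1 !mulr1.
Qed.

Theorem theorem2p15 (k : fieldType) (char_k : [pchar k] =i pred0)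
    (Phi : ncseries k bool) (Phi_gl : group_like Phi)
    (Phi_deg1 : forall x : bool, Phi [:: x] = 0)
    (B : set (UB5 k)) (basisB : UB5_basis B)
    (l : UB5 k -> seq letter5 -> k)
    (l_def : forall W : seq letter5, is_lincomb B (l^~ W) (word5 k W)) :
  pentagon Phi <->
  forall b : UB5 k, B b -> b <> 1 ->
    \sum_(W \in [set: seq letter5]) l b W * C5 Phi W = 0.
Proof.
have := is_eval_seriescomb basisB l_def (is_eval_pentagon char_k Phi).
set x := (X in is_seriescomb _ _ X) => xB; have oneB := seriescomb1 basisB.
split=> [x1 b Bb b1|lC0].
  have {x1} x1 : x = 1 := x1.
  rewrite x1 in xB; rewrite (seriescomb_unique basisB xB oneB Bb).
  by case: eqP.
apply: (seriescomb_inj xB); apply: (seriescomb_ext oneB) => b Bb.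
have [->|/eqP b1] := eqVneq b 1; last by rewrite lC0//; case: eqP.
apply: (coord1_nil basisB l_def).
by apply: C5_nil; case: Phi_gl.
Qed.
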